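(* Consider the 2D first-order Lax–Friedrichs scheme $$\bar{\mathbf U}_{ij}^{n+1}=\bar{\mathbf U}_{ij}^n-\frac{\Delta t_n}{\Delta x}\Big(\hat{\mathbf F}_1(\bar{\mathbf U}_{ij}^n,\bar{\mathbf U}_{i+1,j}^n)-\hat{\mathbf F}_1(\bar{\mathbf U}_{i-1,j}^n,\bar{\mathbf U}_{ij}^n)\Big)-\frac{\Delta t_n}{\Delta y}\Big(\hat{\mathbf F}_2(\bar{\mathbf U}_{ij}^n,\bar{\mathbf U}_{i,j+1}^n)-\hat{\mathbf F}_2(\bar{\mathbf U}_{i,j-1}^n,\bar{\mathbf U}_{ij}^n)\Big),$$ and set $$\mathrm{div}_{ij}\bar{\mathbf B}^n:=\frac{(\bar B_1)_{i+1,j}^n-(\bar B_1)_{i-1,j}^n}{2\Delta x}+\frac{(\bar B_2)_{i,j+1}^n-(\bar B_2)_{i,j-1}^n}{2\Delta y}.$$ Under the condition $$0<\frac{\alpha_{1,n}^{LF}\Delta t_n}{\Delta x}+\frac{\alpha_{2,n}^{LF}\Delta t_n}{\Delta y}\le1$$ the divergence error $\varepsilon_\infty^n:=\max_{ij}|\mathrm{div}_{ij}\bar{\mathbf B}^n|$ does not grow with $n$, i.e. $\varepsilon_\infty^{n+1}\le\varepsilon_\infty^n$. Moreover, $\{\bar{\mathbf U}_{ij}^n\}$ satisfy $\mathrm{div}_{ij}\bar{\mathbf B}^n=0$ for all $i,j$ and $n\in\mathbb N$, if $\mathrm{div}_{ij}\bar{\mathbf B}^0=0$ for all $i,j$ for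 the discrete initial data $\{\bar{\mathbf U}_{ij}^0\}$.
   Context: A state is $\mathbf U=(\rho,\mathbf m,\mathbf B,E)^\top\in\mathbb R^8$ with $\rho,E\in\mathbb R$, $\mathbf m,\mathbf B\in\mathbb R^3$. For $\rho>0$ put $\mathbf v=\mathbf m/\rho$, $e=\frac1\rho\big(E-\frac12(\frac{|\mathbf m|^2}{\rho}+|\mathbf B|^2)\big)$, $p=p(\rho,e)$ (equation of state), $p_{tot}=p+\frac{|\mathbf B|^2}{2}$. Flux: $$\mathbf F_\ell(\mathbf U)=\big(\rho v_\ell,\ \rho v_\ell\mathbf v-B_\ell\mathbf B+p_{tot}\mathbf e_\ell,\ v_\ell\mathbf B-B_\ell\mathbf v,\ v_\ell(E+p_{tot})-B_\ell(\mathbf v\cdot\mathbf B)\big)^\top,$$ with $\mathbf e_\ell$ the $\ell$-th standard unit vector of $\mathbb R^3$. LF flux: $\hat{\mathbf F}_\ell(\mathbf U^-,\mathbf U^+)=\frac12\big(\mathbf F_\ell(\mathbf U^-)+\mathbf F_\ell(\mathbf U^+)-\alpha_{\ell,n}^{LF}(\mathbf U^+-\mathbf U^-)\big)$, where $\alpha_{\ell,n}^{LF}>0$ are numerical viscosity parameters specified at time level $n$. The mesh is uniform rectangular with spacings $\Delta x,\Delta y>0$ and cell indices $(i,j)\in\mathbb Z^2$ (maxima over indices understood as suprema); $\Delta t_n>0$ is the step from level $n$ to $n+1$; $(\bar B_k)_{ij}^n$ is the $k$-th magnetic component of $\bar{\mathbf U}_{ij}^n$. The numerical solution is assumed to have the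 fluxes well defined (positive densities) at every level considered. *)

(* Defs.v *)
From HB Require Import structures.
From mathcomp Require Import all_boot all_order all_algebra.
From mathcomp Require Import all_classical all_reals all_analysis.

Set Implicit Arguments.
Unset Strict Implicit.
Unset Printing Implicit Defensive.

Import Order.TTheory GRing.Theory Num.Theory.

Local Open Scope classical_set_scope.
Local Open Scope ring_scope.

(* R^8, split into the blocks (rho, m, B, E); [1 + (3 + (3 + 1))] reduces to 8. *)
Notation state R := 'rV[R]_(1 + (3 + (3 + 1))).

(* The components 1, 2, 3 of a vector of R^3 have indices 0, 1, 2 in 'I_3. *)
Notation axis1 := (@Ordinal 3 0 isT).
Notation axis2 := (@Ordinal 3 1 isT).

Section MHD.
Variable R : realType.
Implicit Types (U : state R) (l : 'I_3).

Definition mk_state (rho : R) (m B : 'rV[R]_3) (E : R) : state R :=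
  row_mx rho%:M (row_mx m (row_mx B E%:M)).

Definition density U : R := lsubmx U 0 0.
Definition momentum U : 'rV[R]_3 := lsubmx (rsubmx U).
Definition magnetic U : 'rV[R]_3 := lsubmx (rsubmx (rsubmx U)).
Definition energy U : R := rsubmx (rsubmx (rsubmx U)) 0 0.

Definition dot (u v : 'rV[R]_3) : R := \sum_k u 0 k * v 0 k.

Definition velocity U : 'rV[R]_3 := (density U)^-1 *: momentum U.

Definition internal_energy U : R :=
  (density U)^-1 *
  (energy U - 2^-1 * (dot (momentum U) (momentum U) / density U
                      + dot (magnetic U) (magnetic U))).

(* [p] is the equation of state [p(rho, e)]. *)
Definition total_pressure (p : R -> R -> R) U : R :=
  p (density U) (internal_energy U) + dot (magnetic U) (magnetic U) / 2.

Definition flux (p : R -> R -> R) l U : state R :=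
  let rho := density U in
  let v := velocity U in
  let B := magnetic U in
  let E := energy U in
  let ptot := total_pressure p U in
  mk_state
    (rho * v 0 l)
    ((rho * v 0 l) *: v - B 0 l *: B + ptot *: delta_mx 0 l)
    (v 0 l *: B - B 0 l *: v)
    (v 0 l * (E + ptot) - B 0 l * dot v B).

Definition LF_flux (p : R -> R -> R) (alpha : R) l (Um Up : state R) : state R :=
  2^-1 *: (flux p l Um + flux p l Up - alpha *: (Up - Um)).

Definition LF_update (p : R -> R -> R) (dx dy dt alpha1 alpha2 : R)
    (U : int -> int -> state R) (i j : int) : state R :=
  U i j
  - (dt / dx) *: (LF_flux p alpha1 axis1 (U i j) (U (i + 1) j)
                  - LF_flux p alpha1 axis1 (U (i - 1) j) (U i j))
  - (dt / dy) *: (LF_flux p alpha2 axis2 (U i j) (U i (j + 1))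
                  - LF_flux p alpha2 axis2 (U i (j - 1)) (U i j)).

Definition divB (dx dy : R) (U : int -> int -> state R) (i j : int) : R :=
  (magnetic (U (i + 1) j) 0 axis1 - magnetic (U (i - 1) j) 0 axis1) / (2 * dx)
  + (magnetic (U i (j + 1)) 0 axis2 - magnetic (U i (j - 1)) 0 axis2) / (2 * dy).

(* The mesh is infinite, so the supremum may be [+oo]. *)
Definition div_error (dx dy : R) (U : int -> int -> state R) : \bar R :=
  ereal_sup [set (`|divB dx dy U ij.1 ij.2|)%:E | ij in [set: int * int]].

(* The fluxes of the mesh function [U] are well defined. *)
Definition positive_density (U : int -> int -> state R) : Prop :=
  forall i j, 0 < density (U i j).

End MHD.

(* Main.v *)
Require Import Defs.
From HB Require Import structures.
From mathcomp Require Import all_boot all_order all_algebra.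
From mathcomp Require Import all_classical all_reals all_analysis.
From mathcomp Require Import ring.

(** The magnetic part of the flux is antisymmetric: component [k] of the flux
    along axis [l] is [v_l B_k - B_l v_k].  Hence [B_1] is advected only by the
    fluxes along axis 2, [B_2] only by those along axis 1, and both through the
    same scalar [v_1 B_2 - B_1 v_2], with opposite signs.  The centred
    differences in [divB] commute on a uniform mesh, so that this scalar cancels
    from the discrete divergence and only the numerical viscosity is left.

    The viscosity averages every component of the state in the same way.  The
    divergence therefore evolves by a linear five-point formula
    ([divB_LF_update]), whose weights [1 - l1 - l2], [l1 / 2] (twice) and
    [l2 / 2] (twice), with [lk = alpha_k dt / dx_k], sum to 1.  Under the CFL
    condition they are nonnegative: each new divergence is a convex combination
    of old ones, which gives the bound on the supremum.  A vanishing divergence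
    is preserved because the formula is linear. *)

Set Implicit Arguments.
Unset Strict Implicit.
Unset Printing Implicit Defensive.

Import Order.TTheory GRing.Theory Num.Theory.

Local Open Scope ring_scope.

Section DivergenceEvolution.
Variable R : realType.
Implicit Types (p : R -> R -> R) (V : state R) (W : int -> int -> state R).

Lemma magneticD V V' k :
  magnetic (V + V') 0 k = magnetic V 0 k + magnetic V' 0 k.
Proof. by rewrite !mxE. Qed.

Lemma magneticN V k : magnetic (- V) 0 k = - magnetic V 0 k.
Proof. by rewrite !mxE. Qed.

Lemma magneticZ (a : R) V k : magnetic (a *: V) 0 k = a * magnetic V 0 k.
Proof. by rewrite !mxE. Qed.

Lemma magnetic_mk_state (rho : R) m B E : magnetic (mk_state rho m B E) = B.
Proof. by rewrite /magnetic /mk_state !row_mxKr row_mxKl. Qed.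

(** Component [k] along axis [l] of [v (x) B - B (x) v], the flux of the
    induction equation. *)
Definition induction_flux l V k : R :=
  velocity V 0 l * magnetic V 0 k - magnetic V 0 l * velocity V 0 k.

Lemma magnetic_flux p l V k :
  magnetic (flux p l V) 0 k = induction_flux l V k.
Proof. by rewrite /flux magnetic_mk_state /induction_flux !mxE. Qed.

Lemma magnetic_LF_flux p a l V V' k :
  magnetic (LF_flux p a l V V') 0 k =
  2^-1 * (induction_flux l V k + induction_flux l V' k
          - a * (magnetic V' 0 k - magnetic V 0 k)).
Proof.
rewrite /LF_flux -!(magnetic_flux p); do 2![move: (flux _ _ _) => ?].
by rewrite !(magneticZ, magneticD, magneticN).
Qed.

(** The cell itself contributes no induction flux: the numerical flux is a
    centred average, so that [W i j] cancels between opposite edges.  The new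
    state is a variable [V] because the rule is meant for rewriting: comparing
    two explicit updates would unfold both of them. *)
Lemma magnetic_LF_update p dx dy dt a1 a2 W i j V k :
  V = LF_update p dx dy dt a1 a2 W i j ->
  magnetic V 0 k =
  magnetic (W i j) 0 k
  - dt / dx / 2 *
    (induction_flux axis1 (W (i + 1) j) k
     - induction_flux axis1 (W (i - 1) j) k
     - a1 * (magnetic (W (i + 1) j) 0 k + magnetic (W (i - 1) j) 0 k
             - 2 * magnetic (W i j) 0 k))
  - dt / dy / 2 *
    (induction_flux axis2 (W i (j + 1)) k
     - induction_flux axis2 (W i (j - 1)) k
     - a2 * (magnetic (W i (j + 1)) 0 k + magnetic (W i (j - 1)) 0 k
             - 2 * magnetic (W i j) 0 k)).
Proof.
move=> ->; rewrite /LF_update.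
have := magnetic_LF_flux p a1 axis1 (W i j) (W (i + 1) j) k.
have := magnetic_LF_flux p a1 axis1 (W (i - 1) j) (W i j) k.
have := magnetic_LF_flux p a2 axis2 (W i j) (W i (j + 1)) k.
have := magnetic_LF_flux p a2 axis2 (W i (j - 1)) (W i j) k.
(* With the numerical fluxes abstracted, the linearity rules cannot expand
   them. *)
do 4![move: (LF_flux _ _ _ _ _) => ?]; move=> Fs Fn Fw Fe.
rewrite !(magneticD, magneticN, magneticZ) Fs Fn Fw Fe.
by ring.
Qed.

(** This is an identity between the values of the magnetic field and of the
    velocity at the thirteen cells within two steps of [(i, j)]; the velocity
    cancels by the antisymmetry of the magnetic flux.  The new level is a
    variable [W'], tied to [W] by the scheme, so that rewriting never has to
    compare two unfolded updates. *)
Lemma divB_LF_update p dx dy dt a1 a2 W W' i j :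
  dx != 0 -> dy != 0 ->
  (forall k l, W' k l = LF_update p dx dy dt a1 a2 W k l) ->
  let l1 := a1 * dt / dx in
  let l2 := a2 * dt / dy in
  divB dx dy W' i j =
  (1 - l1 - l2) * divB dx dy W i j
  + l1 / 2 * (divB dx dy W (i + 1) j + divB dx dy W (i - 1) j)
  + l2 / 2 * (divB dx dy W i (j + 1) + divB dx dy W i (j - 1)).
Proof.
move=> dx0 dy0 step l1 l2; rewrite /l1 /l2 /divB.
rewrite !(magnetic_LF_update _ (step _ _)) !(addrK, subrK).
by rewrite /induction_flux; field; rewrite dx0 dy0.
Qed.

(** Convexity of the norm: the five weights sum to 1, and the hypotheses on
    [l1] and [l2] say that they are nonnegative. *)
Lemma norm_five_point_average_le (l1 l2 x xe xw xn xs M : R) :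
  0 <= l1 -> 0 <= l2 -> l1 + l2 <= 1 ->
  `|x| <= M -> `|xe| <= M -> `|xw| <= M -> `|xn| <= M -> `|xs| <= M ->
  `|(1 - l1 - l2) * x + l1 / 2 * (xe + xw) + l2 / 2 * (xn + xs)| <= M.
Proof.
move=> l1_ge0 l2_ge0 l12_le1 xM xeM xwM xnM xsM.
have weightedM w y N : 0 <= w -> `|y| <= N -> `|w * y| <= w * N.
  by move=> w_ge0 yN; rewrite normrM ger0_norm// ler_wpM2l.
have sumM y z : `|y| <= M -> `|z| <= M -> `|y + z| <= M + M.
  by move=> yM zM; apply: le_trans (ler_normD _ _) (lerD yM zM).
have -> : M = (1 - l1 - l2) * M + l1 / 2 * (M + M) + l2 / 2 * (M + M) by field.
apply: le_trans (ler_normD _ _) _; apply: lerD; last first.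
  by apply: weightedM; [rewrite divr_ge0 | exact: sumM].
apply: le_trans (ler_normD _ _) _; apply: lerD; apply: weightedM => //.
- by rewrite -addrA -opprD subr_ge0.
- by rewrite divr_ge0.
- exact: sumM.
Qed.

Lemma div_errorP dx dy W (M : R) :
  reflect (forall i j, `|divB dx dy W i j| <= M)
          (div_error dx dy W <= M%:E)%E.
Proof.
apply: (iffP idP) => [le_M i j|le_M].
  rewrite -lee_fin; apply: le_trans le_M.
  by apply: ereal_sup_ubound; exists (i, j).
by apply: ge_ereal_sup => _ [[i j] _ <-]; rewrite lee_fin le_M.
Qed.

(** The supremum on the right may be infinite, in which case there is nothing
    to prove; it is not [-oo] because the mesh is nonempty. *)
Lemma div_error_LF_update_le p dx dy dt a1 a2 W W' :
  0 < dx -> 0 < dy -> 0 <= dt -> 0 <= a1 -> 0 <= a2 ->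
  a1 * dt / dx + a2 * dt / dy <= 1 ->
  (forall k l, W' k l = LF_update p dx dy dt a1 a2 W k l) ->
  (div_error dx dy W' <= div_error dx dy W)%E.
Proof.
move=> dx0 dy0 dt0 a10 a20 cfl step.
case E: (div_error dx dy W) => [M| |]; last 2 first.
- exact: leey.
- have : ((`|divB dx dy W 0 0|)%:E <= div_error dx dy W)%E.
    by apply: ereal_sup_ubound; exists (0, 0).
  by rewrite E leeNy_eq.
have /div_errorP le_M : (div_error dx dy W <= M%:E)%E by rewrite E.
apply/div_errorP => i j; rewrite (divB_LF_update _ _ _ _ step) ?gt_eqF//.
by apply: norm_five_point_average_le => //;
  rewrite divr_ge0 ?mulr_ge0// ltW.
Qed.

Lemma divB_LF_update_eq0 p dx dy dt a1 a2 W W' :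
  dx != 0 -> dy != 0 ->
  (forall k l, W' k l = LF_update p dx dy dt a1 a2 W k l) ->
  (forall i j, divB dx dy W i j = 0) -> forall i j, divB dx dy W' i j = 0.
Proof.
move=> dx0 dy0 step W0 i j.
by rewrite (divB_LF_update _ _ _ _ step)// !W0 !addr0 !mulr0 !addr0.
Qed.

End DivergenceEvolution.

Theorem theorem4p5 (R : realType) (p : R -> R -> R) (dx dy : R)
    (dt alpha1 alpha2 : nat -> R) (U : nat -> int -> int -> state R)
    (dx_gt0 : 0 < dx) (dy_gt0 : 0 < dy)
    (dt_gt0 : forall n, 0 < dt n)
    (alpha1_gt0 : forall n, 0 < alpha1 n)
    (alpha2_gt0 : forall n, 0 < alpha2 n) :
  let scheme_step n := forall i j,
    U n.+1 i j = LF_update p dx dy (dt n) (alpha1 n) (alpha2 n) (U n) i j in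
  let cfl n := 0 < alpha1 n * dt n / dx + alpha2 n * dt n / dy <= 1 in
  (forall n, positive_density (U n) -> scheme_step n -> cfl n ->
     (div_error dx dy (U n.+1) <= div_error dx dy (U n))%E)
  /\
  ((forall i j, divB dx dy (U 0%N) i j = 0) ->
   forall n,
     (forall m, (m < n)%N ->
        [/\ positive_density (U m), scheme_step m & cfl m]) ->
     forall i j, divB dx dy (U n) i j = 0).
Proof.
move=> scheme_step cfl; split=> [n _ step /andP[_ cfln]|div0].
  by apply: div_error_LF_update_le cfln step => //; exact: ltW.
elim=> [//|n IHn steps].
have [_ step _] := steps n (ltnSn n).
apply: (divB_LF_update_eq0 _ _ step); rewrite ?gt_eqF//.
by apply: IHn => m /ltnW; exact: steps.
Qed.
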